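(* Let $\mathbf{A}\in\mathbb{R}^{m\times n}$ be nonzero and $b\in\mathbb{R}^m$ be such that the linear system $\mathbf{A}x=b$ is consistent, with solution set $\mathcal{L}=\{x\in\mathbb{R}^n:\mathbf{A}x=b\}$. Let $\mathcal{D}$ be a distribution over random matrices $\mathbf{S}$ (with $m$ rows), and consider the stochastic optimization reformulation $\min_{x\in\mathbb{R}^n}f(x):=\mathbb{E}_{\mathbf{S}\sim\mathcal{D}}[f_{\mathbf{S}}(x)]$ of the linear system, whose set of minimizers is $\mathcal{X}^*=\mathcal{L}$. Let $x^*$ be the Euclidean projection of $x^0$ onto $\mathcal{X}^*=\mathcal{L}$. Then SGD with SPS with $c=1/2$ applied to this reformulation satisfies, for all $k\ge0$, $$\mathbb{E}\|x^{k}-x^*\|^2\le\left(1-\lambda_{\min}^+(\mathbf{W})\right)^k\|x^0-x^*\|^2,$$ where $\lambda_{\min}^+(\mathbf{W})$ is the smallest nonzero eigenvalue of $\mathbf{W}=\mathbb{E}_{\mathbf{S}\sim\mathcal{D}}[\mathbf{A}^\top\mathbf{H}\mathbf{A}]$.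
   Context: For a random matrix $\mathbf{S}\sim\mathcal{D}$ define $\mathbf{H}:=\mathbf{S}(\mathbf{S}^\top\mathbf{A}\mathbf{A}^\top\mathbf{S})^\dagger\mathbf{S}^\top$, where $\dagger$ is the Moore-Penrose pseudoinverse, and $$f_{\mathbf{S}}(x):=\tfrac12(\mathbf{A}x-b)^\top\mathbf{H}(\mathbf{A}x-b).$$ It is a standing assumption on the reformulation (i.e. on $\mathcal{D}$) that it is equivalent to the linear system: the set $\mathcal{X}^*$ of minimizers of $f$ equals $\mathcal{L}$. SGD: starting from a deterministic $x^0\in\mathbb{R}^n$, at each iteration $k$ a matrix $\mathbf{S}_k\sim\mathcal{D}$ is drawn independently of the past, and $x^{k+1}=x^k-\gamma_k\nabla f_{\mathbf{S}_k}(x^k)$. SPS with $c=1/2$: $\gamma_k=\frac{2\left[f_{\mathbf{S}_k}(x^k)-f_{\mathbf{S}_k}^*\right]}{\|\nabla f_{\mathbf{S}_k}(x^k)\|^2}$, where $f_{\mathbf{S}}^*=\inf_xf_{\mathbf{S}}(x)=0$. If $\nabla f_{\mathbf{S}_k}(x^k)=0$ then $x^{k+1}=x^k$. *)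

(* Defs.v *)
From HB Require Import structures.
From mathcomp Require Import all_boot all_order all_algebra finmap.
From mathcomp Require Import all_classical all_reals all_analysis.

Set Implicit Arguments.
Unset Strict Implicit.
Unset Printing Implicit Defensive.

Import Order.TTheory GRing.Theory Num.Theory.
Import numFieldNormedType.Exports.

Local Open Scope classical_set_scope.
Local Open Scope ring_scope.

Definition enorm (R : realType) (n : nat) (x : 'cV[R]_n) : R :=
  Num.sqrt (\sum_i x i ord0 ^+ 2).

(* The four Penrose equations. *)
Definition penrose (R : realType) (m n : nat) (M : 'M[R]_(m, n))
    (X : 'M[R]_(n, m)) : Prop :=
  [/\ M *m X *m M = M, X *m M *m X = X,
      (M *m X)^T = M *m X & (X *m M)^T = X *m M].

(* Moore-Penrose pseudoinverse; [penrose_mp_pinv] and [penrose_unique] below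
   show that it is the unique solution of the Penrose equations, so that the
   default value 0 is never used.  This is not mathcomp's [pinvmx], which does
   not satisfy the symmetry equations. *)
Definition mp_pinv (R : realType) (m n : nat) (M : 'M[R]_(m, n)) :
    'M[R]_(n, m) :=
  xget 0 [set X | penrose M X].

Section PenroseTheory.
Variable R : realType.

Lemma penrose_unique m n (M : 'M[R]_(m, n)) (X Y : 'M[R]_(n, m)) :
  penrose M X -> penrose M Y -> X = Y.
Proof.
move=> [MXM XMX MXs XMs] [MYM YMY MYs YMs].
have MXY : M *m X = M *m Y.
  have : (M *m Y *m (M *m X))^T = (M *m X)^T by rewrite mulmxA MYM.
  by rewrite trmx_mul MXs MYs mulmxA MXM.
have XMY : X *m M = Y *m M.
  have : (X *m M *m (Y *m M))^T = (X *m M)^T.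
    by rewrite -mulmxA (mulmxA M) MYM.
  by rewrite trmx_mul XMs YMs -mulmxA (mulmxA M) MXM.
by rewrite -XMX XMY -mulmxA MXY mulmxA YMY.
Qed.

Lemma gram_unitmx r n (F : 'M[R]_(r, n)) : row_free F -> F *m F^T \in unitmx.
Proof.
move=> Ffree; rewrite -row_free_unit -kermx_eq0.
apply/eqP/row_matrixP => i; rewrite row0.
set v := row i _.
have vFF : v *m F *m F^T = 0.
  by rewrite -mulmxA -row_mul mulmx_ker row0.
have vF2 : (v *m F) *m (v *m F)^T = 0.
  by rewrite trmx_mul mulmxA vFF mul0mx.
have vF0 : v *m F = 0.
  apply/rowP => j; move/matrixP/(_ ord0 ord0): vF2.
  rewrite [RHS]mxE mxE [LHS](eq_bigr (fun j => (v *m F) ord0 j ^+ 2)); last first.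
    by move=> k _; rewrite [X in _ * X]mxE -expr2.
  move/eqP; rewrite psumr_eq0 => [|k _]; last exact: sqr_ge0.
  by move=> /allP/(_ j (mem_index_enum _)) /=; rewrite sqrf_eq0 [RHS]mxE => /eqP.
by apply: (row_free_inj Ffree); rewrite vF0 mul0mx.
Qed.

Lemma penrose_exists m n (M : 'M[R]_(m, n)) : exists X, penrose M X.
Proof.
have [r [C [F [MCF Cfull Ffree]]]] : exists r, exists C : 'M[R]_(m, r),
    exists F : 'M[R]_(r, n), [/\ C *m F = M, row_full C & row_free F].
  exists (\rank M), (col_base M), (row_base M).
  by rewrite mulmx_base col_base_full row_base_free.
have uF : F *m F^T \in unitmx by exact: gram_unitmx.
have uC : C^T *m C \in unitmx.
  rewrite -[X in _ *m X]trmxK; apply: gram_unitmx.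
  by rewrite /row_free mxrank_tr; exact: Cfull.
have sF : (invmx (F *m F^T))^T = invmx (F *m F^T).
  by rewrite trmx_inv trmx_mul trmxK.
have sC : (invmx (C^T *m C))^T = invmx (C^T *m C).
  by rewrite trmx_inv trmx_mul trmxK.
pose G := F^T *m invmx (F *m F^T); pose K := invmx (C^T *m C) *m C^T.
have FG : F *m G = 1%:M by rewrite mulmxA mulmxV.
have KC : K *m C = 1%:M by rewrite -mulmxA mulVmx.
have MX : M *m (G *m K) = C *m K by rewrite -MCF -mulmxA (mulmxA F) FG mul1mx.
have XM : (G *m K) *m M = G *m F by rewrite -MCF -mulmxA (mulmxA K) KC mul1mx.
exists (G *m K); split.
- by rewrite MX -MCF -mulmxA (mulmxA K) KC mul1mx.
- by rewrite XM -mulmxA (mulmxA F) FG mul1mx.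
- by rewrite MX /K !trmx_mul trmxK sC mulmxA.
- by rewrite XM /G !trmx_mul trmxK sF mulmxA.
Qed.

Lemma penrose_mp_pinv m n (M : 'M[R]_(m, n)) : penrose M (mp_pinv M).
Proof. by apply: (xgetPex 0 (penrose_exists M)). Qed.

End PenroseTheory.

(* Matrices with m rows and an arbitrary (possibly random) number of columns. *)
Definition sketch (R : realType) (m : nat) : Type := {q : nat & 'M[R]_(m, q)}.

Definition sketch_mx (R : realType) (m : nat) (S : sketch R m) :
    'M[R]_(m, projT1 S) := projT2 S.

(* The Borel sigma-algebra of the disjoint union over q of the spaces of
   m x q matrices: a set is measurable iff all its slices are Borel. *)
Definition sketch_measurable (R : realType) (m : nat) : set (set (sketch R m)) :=
  [set B | forall q : nat,
     <<s [set U : set 'M[R]_(m, q) | open U] >>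
       [set M | B (existT (fun q => 'M[R]_(m, q)) q M)]].

Section SketchMeasurable.
Variables (R : realType) (m : nat).

HB.instance Definition _ := Choice.on (sketch R m).
HB.instance Definition _ := isPointed.Build (sketch R m)
  (existT (fun q => 'M[R]_(m, q)) 0%N 0).

Let sketch_measurable0 : @sketch_measurable R m set0.
Proof. by move=> q; exact: sigma_algebra0. Qed.

Let sketch_measurableC (B : set (sketch R m)) :
  sketch_measurable B -> sketch_measurable (~` B).
Proof. by move=> mB q; exact: (sigma_algebraC (mB q)). Qed.

Let sketch_measurableU (B : (set (sketch R m))^nat) :
  (forall i, sketch_measurable (B i)) -> sketch_measurable (\bigcup_i B i).
Proof.
move=> mB q.
rewrite [X in _ X](_ : _ = \bigcup_i
  [set M | B i (existT (fun q => 'M[R]_(m, q)) q M)]) //.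
by apply: sigma_algebra_bigcup => i; exact: mB.
Qed.

Definition sketch_display : measure_display.
Proof. by constructor. Qed.

HB.instance Definition _ := @isMeasurable.Build sketch_display (sketch R m)
  (@sketch_measurable R m)
  sketch_measurable0 sketch_measurableC sketch_measurableU.

End SketchMeasurable.

(* Mutual independence: the product rule over every finite subfamily. *)
Definition mutually_independent (R : realType) (d d' : measure_display)
    (Omega : measurableType d) (T : measurableType d')
    (P : probability Omega R) (X : nat -> Omega -> T) : Prop :=
  forall (I : {fset nat}) (B : nat -> set T),
    (forall i, i \in I -> measurable (B i)) ->
    P (\bigcap_(i in [set` I]) (X i @^-1` B i)) =
    (\prod_(i <- I) P (X i @^-1` B i))%E.

Definition gradient (R : realType) (n : nat) (g : 'cV[R]_n -> R)
    (x : 'cV[R]_n) : 'cV[R]_n :=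
  \col_i 'D_(delta_mx i ord0) g x.

Definition solution_set (R : realType) (m n : nat) (A : 'M[R]_(m, n))
    (b : 'cV[R]_m) : set 'cV[R]_n := [set x | A *m x = b].

Definition minimizers (R : realType) (n : nat) (g : 'cV[R]_n -> \bar R) :
    set 'cV[R]_n := [set x | forall y, (g x <= g y)%E].

Definition is_euclidean_projection (R : realType) (n : nat)
    (L : set 'cV[R]_n) (x p : 'cV[R]_n) : Prop :=
  L p /\ forall y, L y -> enorm (x - p) <= enorm (x - y).

Definition Hmx (R : realType) (m n : nat) (A : 'M[R]_(m, n)) (S : sketch R m) :
    'M[R]_m :=
  let M := sketch_mx S in M *m mp_pinv (M^T *m A *m A^T *m M) *m M^T.

Definition f_S (R : realType) (m n : nat) (A : 'M[R]_(m, n)) (b : 'cV[R]_m)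
    (S : sketch R m) (x : 'cV[R]_n) : R :=
  2^-1 * ((A *m x - b)^T *m Hmx A S *m (A *m x - b)) ord0 ord0.

(* The expectation lives in the extended reals, so no integrability is
   presupposed. *)
Definition f_D (R : realType) (m n : nat) (A : 'M[R]_(m, n)) (b : 'cV[R]_m)
    (D : probability (sketch R m) R) (x : 'cV[R]_n) : \bar R :=
  'E_D[fun S => f_S A b S x].

Definition Wmx (R : realType) (m n : nat) (A : 'M[R]_(m, n))
    (D : probability (sketch R m) R) : 'M[R]_n :=
  \matrix_(i, j) fine 'E_D[fun S => (A^T *m Hmx A S *m A) i j].

(* A matrix has finitely many eigenvalues, so the infimum is the minimum as
   soon as there is a nonzero eigenvalue. *)
Definition lambda_min_plus (R : realType) (n : nat) (W : 'M[R]_n) : R :=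
  inf [set a : R | eigenvalue W a /\ a != 0].

(* Stochastic Polyak step size with c = 1/2. *)
Definition sps_half (R : realType) (n : nat) (g : 'cV[R]_n -> R)
    (x : 'cV[R]_n) : R :=
  2 * (g x - inf (range g)) / enorm (gradient g x) ^+ 2.

Fixpoint sgd_sps (R : realType) (m n : nat) (A : 'M[R]_(m, n)) (b : 'cV[R]_m)
    (S : nat -> sketch R m) (x0 : 'cV[R]_n) (k : nat) : 'cV[R]_n :=
  if k is k'.+1 then
    let x := sgd_sps A b S x0 k' in
    let g := f_S A b (S k') in
    if gradient g x == 0 then x else x - sps_half g x *: gradient g x
  else x0.

(* Main.v *)
From HB Require Import structures.
Require Import Defs.
From mathcomp Require Import all_boot all_order all_algebra finmap.
From mathcomp Require Import all_classical all_reals all_analysis.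
From mathcomp Require Import measurable_realfun ring lra.

Import Order.TTheory GRing.Theory Num.Theory.
Import numFieldNormedType.Exports.

(** For a sketch [S], the matrix [Z = A^T H A] is the orthogonal projector onto
    the range of [A^T S].  Since [A xstar = b],
    [f_S x = 1/2 (x - xstar)^T Z (x - xstar)], whose gradient is
    [Z (x - xstar)] and whose infimum is 0; the Polyak step size with [c = 1/2]
    is therefore exactly 1 whenever the gradient is nonzero, and in all cases
    the error [e_k = x_k - xstar] satisfies [e_(k+1) = (1 - Z_k) e_k]
    ([sgd_sps_step]).  Consequently
    [|e_(k+1)|^2 = e_k^T (1 - Z_k) e_k].

    As [S_k] is independent of [e_k], the expectation of this quantity is that
    of [e_k^T (1 - W) e_k] ([chain_integral], [integral_dotv_complement]).
    The vector [e_0] lies in the row space of [A], because [xstar] is the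
    projection of [x0] on the solution set, and the recursion preserves the row
    space, so every [e_k] lies in it.  Exactness of the reformulation gives
    [ker W = ker A]; hence on the row space, which is orthogonal to this kernel,
    the Rayleigh quotient of [W] is at least its smallest nonzero eigenvalue
    ([lambda_min_plus_le]), and each step contracts the expectation by the
    factor [1 - lambda], which is nonnegative because [W <= 1].

    Three points need care.  The pseudoinverse is not continuous, so the
    measurability of [S |-> Z] is obtained from the Gram-Schmidt recursion
    ([range_proj_gs], [measurable_sketch_proj]).  The Rayleigh bound is proved
    without diagonalizing [W]: the quotient attains its minimum on the compact
    unit sphere of the row space, and a minimizer is an eigenvector
    ([rayleigh_min]).  Independence is given as the product rule for events of
    the sketches; it is transferred to the pair [(e_k, S_k)] by induction on
    [k], which makes the law of this pair a product measure
    ([chain_indep_future]). *)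

Set Implicit Arguments.
Unset Strict Implicit.
Unset Printing Implicit Defensive.

Local Open Scope classical_set_scope.
Local Open Scope ring_scope.

(** * The Euclidean dot product *)

(** The dot product of column vectors. *)
Definition dotv (R : realType) (n : nat) (u v : 'cV[R]_n) : R :=
  (u^T *m v) ord0 ord0.

Lemma dotvE (R : realType) n (u v : 'cV[R]_n) :
  dotv u v = \sum_i u i ord0 * v i ord0.
Proof. by rewrite /dotv mxE; apply: eq_bigr => i _; rewrite mxE. Qed.

Lemma dotvC (R : realType) n (u v : 'cV[R]_n) : dotv u v = dotv v u.
Proof. by rewrite !dotvE; apply: eq_bigr => i _; rewrite mulrC. Qed.

Lemma dotvDl (R : realType) n (u v w : 'cV[R]_n) :
  dotv (u + v) w = dotv u w + dotv v w.
Proof. by rewrite /dotv linearD mulmxDl mxE. Qed.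

Lemma dotvNl (R : realType) n (u v : 'cV[R]_n) : dotv (- u) v = - dotv u v.
Proof. by rewrite /dotv linearN mulNmx mxE. Qed.

Lemma dotvZl (R : realType) n a (u v : 'cV[R]_n) :
  dotv (a *: u) v = a * dotv u v.
Proof. by rewrite /dotv linearZ -scalemxAl mxE. Qed.

Lemma dotvDr (R : realType) n (u v w : 'cV[R]_n) :
  dotv w (u + v) = dotv w u + dotv w v.
Proof. by rewrite /dotv mulmxDr mxE. Qed.

Lemma dotvNr (R : realType) n (u v : 'cV[R]_n) : dotv u (- v) = - dotv u v.
Proof. by rewrite /dotv mulmxN mxE. Qed.

Lemma dotvZr (R : realType) n a (u v : 'cV[R]_n) :
  dotv u (a *: v) = a * dotv u v.
Proof. by rewrite /dotv -scalemxAr mxE. Qed.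

Lemma dot0v (R : realType) n (u : 'cV[R]_n) : dotv 0 u = 0.
Proof. by rewrite /dotv linear0 mul0mx mxE. Qed.

Lemma dotv_mull (R : realType) m n (M : 'M[R]_(m, n)) u v :
  dotv (M *m u) v = dotv u (M^T *m v).
Proof. by rewrite /dotv trmx_mul mulmxA. Qed.

Lemma dotv_ge0 (R : realType) n (u : 'cV[R]_n) : 0 <= dotv u u.
Proof. by rewrite dotvE sumr_ge0 // => i _; rewrite -expr2 sqr_ge0. Qed.

Lemma dotv_eq0 (R : realType) n (u : 'cV[R]_n) : (dotv u u == 0) = (u == 0).
Proof.
apply/idP/eqP => [|->]; last by rewrite dot0v.
rewrite dotvE psumr_eq0 => [/allP u0|i _]; last by rewrite -expr2 sqr_ge0.
apply/colP => i; have /= := u0 i (mem_index_enum _).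
by rewrite -expr2 sqrf_eq0 mxE => /eqP.
Qed.

Lemma enorm_sqr (R : realType) n (u : 'cV[R]_n) : enorm u ^+ 2 = dotv u u.
Proof.
rewrite /enorm sqr_sqrtr; last by apply: sumr_ge0 => i _; rewrite sqr_ge0.
by rewrite dotvE; apply: eq_bigr => i _; rewrite expr2.
Qed.

(** * Orthogonal projectors and Gram-Schmidt *)

(** A square matrix that is the matrix of an orthogonal projection. *)
Definition orthoproj (R : realType) (n : nat) (Q : 'M[R]_n) : Prop :=
  Q^T = Q /\ Q *m Q = Q.

Lemma orthoprojC (R : realType) n (Q : 'M[R]_n) :
  orthoproj Q -> orthoproj (1%:M - Q).
Proof.
move=> [Qs QQ]; split; first by rewrite linearB /= trmx1 Qs.
by rewrite mulmxBl mul1mx mulmxBr mulmx1 QQ subrr subr0.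
Qed.

Lemma orthoproj_dotv (R : realType) n (Q : 'M[R]_n) u :
  orthoproj Q -> dotv u (Q *m u) = dotv (Q *m u) (Q *m u).
Proof. by move=> [Qs QQ]; rewrite dotv_mull Qs mulmxA QQ. Qed.

Lemma orthoproj_pythagoras (R : realType) n (Q : 'M[R]_n) u :
  orthoproj Q ->
  dotv u u = dotv (Q *m u) (Q *m u) + dotv (u - Q *m u) (u - Q *m u).
Proof.
move=> Qp; rewrite -(orthoproj_dotv _ Qp).
have -> : u - Q *m u = (1%:M - Q) *m u by rewrite mulmxBl mul1mx.
rewrite -(orthoproj_dotv _ (orthoprojC Qp)) -dotvDr -mulmxDl.
by rewrite addrC subrK mul1mx.
Qed.

Lemma gram_eq0 (R : realType) m n (X : 'M[R]_(m, n)) : X^T *m X = 0 -> X = 0.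
Proof.
move=> XX; apply/matrixP => i j; rewrite mxE.
have /eqP : dotv (col j X) (col j X) = 0.
  by rewrite !colE dotv_mull mulmxA XX mul0mx dotvC dot0v.
by rewrite dotv_eq0 => /eqP /colP /(_ i); rewrite !mxE.
Qed.

Lemma penrose_trmx (R : realType) m n (M : 'M[R]_(m, n)) X :
  penrose M X -> penrose M^T X^T.
Proof.
move=> [MXM XMX MXs XMs]; split.
- by rewrite -!trmx_mul mulmxA MXM.
- by rewrite -!trmx_mul mulmxA XMX.
- by rewrite -trmx_mul XMs.
- by rewrite -trmx_mul MXs.
Qed.

Lemma mp_pinv_sym (R : realType) n (M : 'M[R]_n) :
  M^T = M -> (mp_pinv M)^T = mp_pinv M.
Proof.
move=> Ms; apply: (@penrose_unique _ _ _ M); last exact: penrose_mp_pinv.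
by rewrite -{1}Ms; apply: penrose_trmx; exact: penrose_mp_pinv.
Qed.

(** The orthogonal projector onto the column space of [B]. *)
Definition range_proj (R : realType) (n q : nat) (B : 'M[R]_(n, q)) : 'M[R]_n :=
  B *m mp_pinv (B^T *m B) *m B^T.

Lemma range_proj_orthoproj (R : realType) n q (B : 'M[R]_(n, q)) :
  orthoproj (range_proj B).
Proof.
have Gs : (B^T *m B)^T = B^T *m B by rewrite trmx_mul trmxK.
have [_ XMX _ _] := penrose_mp_pinv (B^T *m B).
split; first by rewrite /range_proj !trmx_mul trmxK mp_pinv_sym // mulmxA.
rewrite /range_proj -{3}XMX !mulmxA; congr (_ *m _).
Qed.

Lemma range_proj_id (R : realType) n q (B : 'M[R]_(n, q)) :
  range_proj B *m B = B.
Proof.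
have [MXM _ _ _] := penrose_mp_pinv (B^T *m B).
apply/eqP; rewrite eq_sym -subr_eq0; apply/eqP; apply: gram_eq0.
set X := B - _.
have BX : B^T *m X = 0.
  by rewrite mulmxBr /range_proj !mulmxA -(mulmxA _ B^T B) MXM subrr.
have -> : X = (1%:M - range_proj B) *m B by rewrite mulmxBl mul1mx.
have [s1 i1] := orthoprojC (range_proj_orthoproj B).
rewrite trmx_mul s1 -mulmxA (mulmxA (1%:M - _)) i1 mulmxBl mul1mx -/X.
exact: BX.
Qed.

(** One Gram-Schmidt step: [Q] projects onto a subspace, and the result
    projects onto its sum with the line of [v].  When [v] already lies in the
    subspace, the residual is 0 and the inverse of 0, being 0, is harmless. *)
Definition gs_step (R : realType) (n : nat) (Q : 'M[R]_n) (v : 'cV[R]_n) :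
    'M[R]_n :=
  let r := v - Q *m v in Q + (dotv r r)^-1 *: (r *m r^T).

Lemma mul_cVdotv (R : realType) n (r u : 'cV[R]_n) :
  r *m r^T *m u = dotv r u *: r.
Proof.
apply/colP => i; rewrite -mulmxA [LHS]mxE big_ord1 [in RHS]mxE mulrC.
by rewrite /dotv.
Qed.

Lemma gs_stepE (R : realType) n (Q : 'M[R]_n) v u :
  gs_step Q v *m u =
    Q *m u + (dotv (v - Q *m v) (v - Q *m v))^-1 * dotv (v - Q *m v) u
      *: (v - Q *m v).
Proof. by rewrite /gs_step mulmxDl -scalemxAl mul_cVdotv scalerA. Qed.

Lemma gs_step_residual (R : realType) n (Q : 'M[R]_n) (v : 'cV[R]_n) :
  orthoproj Q -> Q *m (v - Q *m v) = 0.
Proof. by move=> [_ QQ]; rewrite mulmxBr mulmxA QQ subrr. Qed.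

Lemma gs_step_dotv (R : realType) n (Q : 'M[R]_n) (v u : 'cV[R]_n) :
  orthoproj Q -> Q *m u = u -> dotv (v - Q *m v) u = 0.
Proof.
move=> Qp Qu; have [Qs _] := Qp.
by rewrite -Qu -{2}Qs -dotv_mull gs_step_residual // dot0v.
Qed.

Lemma gs_step_fix (R : realType) n (Q : 'M[R]_n) (v u : 'cV[R]_n) :
  orthoproj Q -> Q *m u = u -> gs_step Q v *m u = u.
Proof.
by move=> Qp Qu; rewrite gs_stepE (gs_step_dotv v Qp Qu) Qu mulr0 scale0r addr0.
Qed.

Lemma gs_step_fix_new (R : realType) n (Q : 'M[R]_n) (v : 'cV[R]_n) :
  orthoproj Q -> gs_step Q v *m v = v.
Proof.
move=> Qp; have [Qs QQ] := Qp; rewrite gs_stepE; set r := v - Q *m v.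
have -> : dotv r v = dotv r r.
  rewrite {3}/r dotvDr dotvNr (gs_step_dotv (u := Q *m v) v Qp) ?subr0 //.
  by rewrite mulmxA QQ.
have [r0|r0] := eqVneq r 0.
  by rewrite r0 scaler0 addr0; apply/esym/eqP; rewrite -subr_eq0 -/r r0.
by rewrite mulVf ?dotv_eq0 // scale1r /r addrC subrK.
Qed.

Lemma gs_step_orthoproj (R : realType) n (Q : 'M[R]_n) (v : 'cV[R]_n) :
  orthoproj Q -> orthoproj (gs_step Q v).
Proof.
move=> Qp; have [Qs QQ] := Qp; split.
  by rewrite /gs_step linearD linearZ /= Qs trmx_mul trmxK.
rewrite {2 3}/gs_step mulmxDr -scalemxAr mulmxA.
congr (_ + _); last congr (_ *: (_ *m _)).
  apply/matrixP => i j.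
  have := gs_step_fix v (u := col j Q) Qp.
  by rewrite !colE !mulmxA QQ => /(_ erefl) /colP/(_ i); rewrite -!colE !mxE.
by rewrite mulmxBr gs_step_fix_new // gs_step_fix // mulmxA QQ.
Qed.

Lemma gs_step_sub (R : realType) n (Q Q' : 'M[R]_n) v :
  Q' *m Q = Q -> Q' *m v = v -> Q' *m gs_step Q v = gs_step Q v.
Proof.
move=> QQ' Qv; rewrite /gs_step mulmxDr QQ' -scalemxAr mulmxA mulmxBr mulmxA.
by rewrite QQ' Qv.
Qed.

(** The last clause says that the range does not grow more than necessary:
    whatever fixes the start and the vectors of the sequence fixes the result. *)
Lemma gs_foldl (R : realType) n (s : seq 'cV[R]_n) (Q0 : 'M[R]_n) :
  orthoproj Q0 ->
  let Q := foldl (@gs_step R n) Q0 s in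
  [/\ orthoproj Q, forall u : 'cV[R]_n, Q0 *m u = u -> Q *m u = u,
      forall v, v \in s -> Q *m v = v
    & forall Q', Q' *m Q0 = Q0 -> (forall v, v \in s -> Q' *m v = v) ->
        Q' *m Q = Q].
Proof.
elim: s Q0 => [|v s IHs] Q0 Qp //=.
have [op fix0 fixs sub] := IHs _ (gs_step_orthoproj v Qp); split=> //.
- by move=> u Qu; apply: fix0; exact: gs_step_fix.
- move=> u; rewrite inE => /orP[/eqP -> |/fixs //].
  by apply: fix0; exact: gs_step_fix_new.
- move=> Q' QQ' fixQ'; apply: sub.
    by apply: gs_step_sub => //; apply: fixQ'; rewrite mem_head.
  by move=> u us; apply: fixQ'; rewrite inE us orbT.
Qed.

(** Folding the Gram-Schmidt step over the columns computes the projector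
    without a pseudoinverse. *)
Lemma range_proj_gs (R : realType) n q (B : 'M[R]_(n, q)) :
  range_proj B = foldl (@gs_step R n) 0 [seq col j B | j <- enum 'I_q].
Proof.
have p0 : orthoproj (0 : 'M[R]_n) by split; rewrite ?linear0 ?mulmx0.
have /= := @gs_foldl _ _ [seq col j B | j <- enum 'I_q] 0 p0.
set Q := foldl _ _ _; move=> [[Qs QQ] _ fixs sub].
have [Zs _] := range_proj_orthoproj B.
have QB : Q *m B = B.
  apply/matrixP => i j.
  have /fixs : col j B \in [seq col j B | j <- enum 'I_q].
    by apply/mapP; exists j => //; rewrite mem_enum.
  by rewrite !colE mulmxA -!colE => /colP/(_ i); rewrite !mxE.
(* Each of the two projectors fixes the range of the other. *)
have <- : Q *m range_proj B = range_proj B.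
  by rewrite {1}/range_proj !mulmxA QB.
apply: trmx_inj; rewrite trmx_mul Zs Qs; apply: sub; first by rewrite mulmx0.
by move=> v /mapP[j _ ->]; rewrite !colE mulmxA range_proj_id.
Qed.

(** * The Polyak step is an exact projection *)

(** The random matrix [A^T H A]. *)
Definition sketch_proj (R : realType) m n (A : 'M[R]_(m, n)) (S : sketch R m) :
    'M[R]_n := A^T *m Hmx A S *m A.

Lemma sketch_projE (R : realType) m n (A : 'M[R]_(m, n)) (S : sketch R m) :
  sketch_proj A S = range_proj (A^T *m sketch_mx S).
Proof. by rewrite /sketch_proj /Hmx /range_proj trmx_mul trmxK !mulmxA. Qed.

Lemma sketch_proj_orthoproj (R : realType) m n (A : 'M[R]_(m, n)) S :
  orthoproj (sketch_proj A S).
Proof. by rewrite sketch_projE; exact: range_proj_orthoproj. Qed.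

Lemma f_SE (R : realType) m n (A : 'M[R]_(m, n)) b S (c x : 'cV[R]_n) :
  A *m c = b ->
  f_S A b S x = 2^-1 * dotv (x - c) (sketch_proj A S *m (x - c)).
Proof.
move=> <-; rewrite /f_S -mulmxBr trmx_mul /dotv /sketch_proj.
by rewrite !mulmxA.
Qed.

Lemma gradient_quadratic (R : realType) n (Q : 'M[R]_n) (c x : 'cV[R]_n) :
  Q^T = Q ->
  gradient (fun y => 2^-1 * dotv (y - c) (Q *m (y - c))) x = Q *m (x - c).
Proof.
move=> Qs; apply/colP => i; rewrite mxE; set v := delta_mx i ord0.
have -> : (Q *m (x - c)) i ord0 = dotv v (Q *m (x - c)).
  rewrite dotvE (bigD1 i) //= big1 => [|j ji].
    by rewrite /v [delta_mx _ _ _ _]mxE !eqxx mul1r addr0.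
  by rewrite /v mxE (negPf ji) mul0r.
apply/cvg_lim => //; move: (x - c) (subrK c x) => e xE.
set a := dotv v (Q *m e); set q := dotv v (Q *m v); pose r := 2^-1 * q.
apply: (@cvg_trans _ ((fun h : R => a + h * r) @ 0^')).
  apply: near_eq_cvg; near=> h.
  have h0 : h != 0 by near: h; exact: nbhs_dnbhs_neq.
  have Qa : dotv e (Q *m v) = a by rewrite /a dotvC dotv_mull Qs.
  have -> :
      ((fun y => 2^-1 * dotv (y - c) (Q *m (y - c))) \o shift x) (h *: v) =
      2^-1 * (h * (h * q + a) + (h * a + dotv e (Q *m e))).
    rewrite /= -xE addrA addrK mulmxDr -scalemxAr.
    by rewrite !(dotvDl, dotvDr) !(dotvZl, dotvZr) Qa -/a -/q (mulrDr h).
  rewrite /r /GRing.scale /=; by field.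
have : (fun h : R => a + h * r) @ 0 --> a + 0 * r.
  apply: cvgD; first exact: cvg_cst.
  by apply: cvgM; [exact: cvg_id|exact: cvg_cst].
rewrite mul0r addr0; apply: cvg_trans; apply: cvg_app; exact: cvg_within.
Unshelve. all: by end_near. Qed.

Lemma inf_f_S (R : realType) m n (A : 'M[R]_(m, n)) b S (c : 'cV[R]_n) :
  A *m c = b -> inf (range (f_S A b S)) = 0.
Proof.
move=> Acb; have fE := f_SE S _ Acb.
have f_ge0 y : 0 <= f_S A b S y.
  rewrite fE (orthoproj_dotv _ (sketch_proj_orthoproj A S)).
  by rewrite mulr_ge0 ?dotv_ge0 ?invr_ge0.
have f0 : range (f_S A b S) 0.
  by exists c => //; rewrite fE subrr dot0v mulr0.
apply/eqP; rewrite eq_le; apply/andP; split.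
  by apply: ge_inf => //; exists 0 => _ [y _ <-].
by apply: lb_le_inf; [exists 0 | move=> _ [y _ <-]].
Qed.

(** The Polyak step size is 1 when the gradient does not vanish; when it does,
    the projector kills the error and the identity still holds. *)
Lemma sgd_sps_step (R : realType) m n (A : 'M[R]_(m, n)) b
    (S : nat -> sketch R m) (x0 c : 'cV[R]_n) k :
  A *m c = b ->
  sgd_sps A b S x0 k.+1 - c =
    (1%:M - sketch_proj A (S k)) *m (sgd_sps A b S x0 k - c).
Proof.
move=> Acb /=; set x := sgd_sps A b S x0 k; set Z := sketch_proj A (S k).
have Zp : orthoproj Z by exact: sketch_proj_orthoproj.
have fE : f_S A b (S k) = fun y => 2^-1 * dotv (y - c) (Z *m (y - c)).
  by apply/funext => y; exact: f_SE.
have -> : gradient (f_S A b (S k)) x = Z *m (x - c).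
  by rewrite fE gradient_quadratic //; have [] := Zp.
rewrite mulmxBl mul1mx; case: eqVneq => [->|g0]; first by rewrite subr0.
suff -> : sps_half (f_S A b (S k)) x = 1 by rewrite scale1r addrAC.
rewrite /sps_half (inf_f_S (S k) Acb) subr0 fE gradient_quadratic; last first.
  by have [] := Zp.
rewrite enorm_sqr orthoproj_dotv // mulrA mulfV ?mul1r ?divff //.
by rewrite dotv_eq0.
Qed.

(** * The smallest nonzero eigenvalue as a Rayleigh bound *)

Lemma quadratic_continuous (R : realType) n (M : 'M[R]_n) :
  continuous (fun u : 'rV[R]_n => dotv u^T (M *m u^T)).
Proof.
move=> u.
rewrite (_ : (fun u : 'rV[R]_n => _) =
  fun u : 'rV[R]_n => \sum_i u ord0 i * \sum_j M i j * u ord0 j); last first.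
  apply/funext => v; rewrite dotvE; apply: eq_bigr => i _; rewrite !mxE.
  by congr (_ * _); apply: eq_bigr => j _; rewrite mxE.
have cc i : {for u, continuous (fun v : 'rV[R]_n => v ord0 i)}.
  exact: coord_continuous.
apply: (cvg_big (F := nbhs u) add_continuous) => i _.
apply: cvgM; first exact: cc.
apply: (cvg_big (F := nbhs u) add_continuous) => j _.
by apply: cvgM; [exact: cvg_cst | exact: cc].
Qed.

(** On the range of an orthogonal projector [T], the Rayleigh quotient of a
    symmetric matrix [W] with [W *m T = W] attains its minimum, and a minimizer
    is an eigenvector. *)
Lemma rayleigh_min (R : realType) n (W T : 'M[R]_n) (x : 'cV[R]_n) :
  W^T = W -> orthoproj T -> W *m T = W -> T *m x = x -> x != 0 ->
  exists y : 'cV[R]_n, exists mu : R,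
    [/\ y != 0, T *m y = y, W *m y = mu *: y &
        forall z, T *m z = z -> mu * dotv z z <= dotv z (W *m z)].
Proof.
move=> Ws Tp WT Tx x0; have [Ts TT] := Tp.
have TW : T *m W = W by rewrite -[RHS]Ws -{2}WT trmx_mul Ts Ws.
pose qf (M : 'M[R]_n) (u : 'rV[R]_n) := dotv u^T (M *m u^T).
(* The unit sphere of the range of [T], as a closed set cut out by two quadratic
   forms; row vectors carry the compactness theorem. *)
pose K := (qf 1%:M @^-1` [set 1]) `&` (qf (1%:M - T) @^-1` [set 0]).
have KP u : K u <-> dotv u^T u^T = 1 /\ T *m u^T = u^T.
  rewrite /K /qf /= mul1mx.
  split=> -[-> h]; split=> //.
    move: h; rewrite (orthoproj_dotv _ (orthoprojC Tp)) => /eqP.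
    by rewrite dotv_eq0 mulmxBl mul1mx subr_eq0 => /eqP.
  by rewrite mulmxBl mul1mx h subrr dotvC dot0v.
have normalize z : z != 0 -> T *m z = z ->
    K ((Num.sqrt (dotv z z))^-1 *: z)^T.
  move=> z0 Tz; apply/KP; rewrite trmxK; split; last by rewrite -scalemxAr Tz.
  rewrite dotvZl dotvZr mulrA -invfM -expr2 sqr_sqrtr ?dotv_ge0 //.
  by rewrite mulVf // dotv_eq0.
have Kc : compact K.
  apply: bounded_closed_compact.
    exists 1; split=> // M M1 u /KP[u1 _]; apply: le_trans (ltW M1).
    rewrite /Num.norm /= mx_normrE; apply: bigmax_le => //= -[i j] _ /=.
    rewrite (ord1 i) -(expr_le1 (n := 2)) // real_normK ?num_real //.
    move: u1; rewrite dotvE (bigD1 j) //= mxE -expr2 => <-.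
    by rewrite lerDl sumr_ge0 // => l _; rewrite -expr2 sqr_ge0.
  apply: closedI.
    apply: closed_comp; last exact: closed_eq.
    by move=> u _; exact: quadratic_continuous.
  apply: closed_comp; last exact: closed_eq.
  by move=> u _; exact: quadratic_continuous.
have K0 : K !=set0 by eexists; exact: normalize x0 Tx.
have cW : {within K, continuous (qf W)}.
  by apply: continuous_subspaceT; exact: quadratic_continuous.
have [u /set_mem/KP[u1 Tu] umin] := compact_EVT_min K0 Kc cW.
set y := u^T in u1 Tu; pose mu := dotv y (W *m y).
have min z : T *m z = z -> mu * dotv z z <= dotv z (W *m z).
  have [-> _|z0 Tz] := eqVneq z 0; first by rewrite !dot0v mulr0.
  have zz : 0 < dotv z z by rewrite lt_def dotv_eq0 z0 dotv_ge0.
  have := umin _ (mem_set (normalize _ z0 Tz)).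
  rewrite /qf trmxK -scalemxAr dotvZl dotvZr mulrA -invfM -expr2.
  rewrite sqr_sqrtr ?dotv_ge0 // -/y -/mu -(ler_pM2r zz).
  by rewrite mulrAC mulVf ?mul1r // gt_eqF.
exists y, mu; split=> //.
  by rewrite -dotv_eq0 u1 oner_eq0.
(* The form of [W - mu] is nonnegative on the range of [T] and vanishes at
   [y]; expanding it at [y - t *: g], where [g] is its gradient, forces
   [g = 0]. *)
have [g gE] : exists g, g = W *m y - mu *: y by exists (W *m y - mu *: y).
have Tg : T *m g = g by rewrite gE mulmxBr mulmxA TW -scalemxAr Tu.
have Wyg : dotv y (W *m g) = dotv g (W *m y).
  by rewrite dotvC dotv_mull Ws.
have gg : dotv g g = dotv g (W *m y) - mu * dotv y g.
  by rewrite {2}gE dotvDr dotvNr dotvZr (dotvC y).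
suff : g == 0 by rewrite gE subr_eq0 => /eqP.
rewrite -dotv_eq0; apply/negPn/negP => gn0.
have g_gt0 : 0 < dotv g g by rewrite lt_def gn0 dotv_ge0.
pose q := dotv g (W *m g) - mu * dotv g g.
have q_ge0 : 0 <= q by rewrite subr_ge0; exact: min.
have key t : 0 <= t ^+ 2 * q - 2 * t * dotv g g.
  have := min (y - t *: g).
  rewrite mulmxBr -scalemxAr Tu Tg => /(_ erefl).
  rewrite mulmxBr -scalemxAr !(dotvDl, dotvDr, dotvNl, dotvNr, dotvZl, dotvZr).
  rewrite -/mu Wyg (dotvC g y) u1 /q.
  by move: gg => /eqP; rewrite eq_sym subr_eq => /eqP ->; lra.
(* With this [t], the right-hand side of [key] is [- t ^+ 2 * (q + 2)]. *)
have := key (dotv g g / (q + 1)).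
have q1 : 0 < q + 1 by rewrite ltr_wpDl.
set t := _ / _; have tq : t * (q + 1) = dotv g g by rewrite mulfVK // gt_eqF.
have t_gt0 : 0 < t by rewrite divr_gt0.
by rewrite -tq; nra.
Qed.

(** The smallest nonzero eigenvalue of a positive semidefinite [W] bounds its
    Rayleigh quotient from below on the range of [T], on which [W] is
    injective. *)
Lemma lambda_min_plus_le (R : realType) n (W T : 'M[R]_n) (x : 'cV[R]_n) :
  W^T = W -> (forall z : 'cV[R]_n, 0 <= dotv z (W *m z)) ->
  orthoproj T -> W *m T = W ->
  (forall z : 'cV[R]_n, T *m z = z -> W *m z = 0 -> z = 0) ->
  T *m x = x -> lambda_min_plus W * dotv x x <= dotv x (W *m x).
Proof.
move=> Ws W0 Tp WT kerW Tx.
have [->|x0] := eqVneq x 0; first by rewrite !dot0v mulr0.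
have [y [mu [y0 Ty Wy mumin]]] := rayleigh_min Ws Tp WT Tx x0.
apply: le_trans (mumin _ Tx); rewrite ler_wpM2r ?dotv_ge0 //.
have ev z a : z *m W = a *: z -> W *m z^T = a *: z^T.
  by move=> h; rewrite -{1}Ws -trmx_mul h linearZ.
apply: ge_inf.
  exists 0 => a [/eigenvalueP[v /ev Wv v0] _].
  have vv : 0 < dotv v^T v^T.
    by rewrite lt_def dotv_ge0 dotv_eq0 trmx_eq0 v0.
  by have := W0 v^T; rewrite Wv dotvZr pmulr_lge0.
split.
  apply/eigenvalueP; exists y^T; last by rewrite trmx_eq0.
  by rewrite -{1}Ws -trmx_mul Wy linearZ.
by apply: contra_neq y0 => mu0; apply: kerW => //; rewrite Wy mu0 scale0r.
Qed.

(** * Measurability of the projectors *)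

Section measurable_matrices.
Context {d : measure_display} {T : measurableType d} {R : realType}.

(** Measurability of a matrix-valued function, entry by entry. *)
Definition measurable_mx (p q : nat) (f : T -> 'M[R]_(p, q)) : Prop :=
  forall i j, measurable_fun setT (fun t => f t i j).

Lemma measurable_mx_cst p q (M : 'M[R]_(p, q)) : measurable_mx (fun=> M).
Proof. by move=> i j; exact: measurable_cst. Qed.

Lemma measurable_mxD p q (f g : T -> 'M[R]_(p, q)) :
  measurable_mx f -> measurable_mx g -> measurable_mx (fun t => f t + g t).
Proof.
move=> mf mg i j; under eq_fun do rewrite mxE.
by apply: measurable_funD; [exact: mf|exact: mg].
Qed.

Lemma measurable_mxN p q (f : T -> 'M[R]_(p, q)) :
  measurable_mx f -> measurable_mx (fun t => - f t).
Proof.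
move=> mf i j; under eq_fun do rewrite mxE.
by apply: measurableT_comp => //; exact: mf.
Qed.

Lemma measurable_mxZ p q (r : T -> R) (f : T -> 'M[R]_(p, q)) :
  measurable_fun setT r -> measurable_mx f ->
  measurable_mx (fun t => r t *: f t).
Proof.
move=> mr mf i j; under eq_fun do rewrite mxE.
by apply: measurable_funM => //; exact: mf.
Qed.

Lemma measurable_mx_tr p q (f : T -> 'M[R]_(p, q)) :
  measurable_mx f -> measurable_mx (fun t => (f t)^T).
Proof. by move=> mf i j; under eq_fun do rewrite mxE; exact: mf. Qed.

Lemma measurable_mxM p q r (f : T -> 'M[R]_(p, q)) (g : T -> 'M[R]_(q, r)) :
  measurable_mx f -> measurable_mx g -> measurable_mx (fun t => f t *m g t).
Proof.
move=> mf mg i j; under eq_fun do rewrite mxE.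
apply: measurable_sum => k.
by apply: measurable_funM; [exact: mf|exact: mg].
Qed.

Lemma measurable_dotv p (f g : T -> 'cV[R]_p) :
  measurable_mx f -> measurable_mx g ->
  measurable_fun setT (fun t => dotv (f t) (g t)).
Proof.
by move=> mf mg; apply: measurable_mxM => //; exact: measurable_mx_tr.
Qed.

Lemma measurable_gs_step p (Q : T -> 'M[R]_p) (v : T -> 'cV[R]_p) :
  measurable_mx Q -> measurable_mx v ->
  measurable_mx (fun t => gs_step (Q t) (v t)).
Proof.
move=> mQ mv.
have mr : measurable_mx (fun t => v t - Q t *m v t).
  by apply: measurable_mxD => //; apply: measurable_mxN; exact: measurable_mxM.
apply: measurable_mxD => //; apply: measurable_mxZ; last first.
  by apply: measurable_mxM => //; exact: measurable_mx_tr.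
(* The squared length being nonnegative, its inverse is a real power. *)
under eq_fun do rewrite -(powR_inv1 (dotv_ge0 _)).
apply: (measurableT_comp (measurable_powR (- 1))).
exact: measurable_dotv.
Qed.

Lemma measurable_range_proj p q (B : T -> 'M[R]_(p, q)) :
  measurable_mx B -> measurable_mx (fun t => range_proj (B t)).
Proof.
move=> mB; under eq_fun do rewrite range_proj_gs.
suff fold s (Q0 : T -> 'M[R]_p) : measurable_mx Q0 ->
    measurable_mx (fun t =>
      foldl (@gs_step R p) (Q0 t) [seq col j (B t) | j <- s]).
  by apply: (fold _ (fun=> 0)); exact: measurable_mx_cst.
elim: s Q0 => [//|j s IHs] Q0 mQ0 /=.
apply: (IHs (fun t => gs_step (Q0 t) (col j (B t)))).
apply: measurable_gs_step => // i k.
by under eq_fun do rewrite mxE; exact: mB.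
Qed.

End measurable_matrices.

(** The matrices of a fixed size with the Borel sigma-algebra. *)
Definition borel_mx (R : realType) (m q : nat) :=
  g_sigma_algebraType [set U : set 'M[R]_(m, q) | open U].

Lemma measurable_coord (R : realType) m q (i : 'I_m) (j : 'I_q) :
  measurable_fun [set: borel_mx R m q] (fun M : 'M[R]_(m, q) => M i j).
Proof.
apply: (measurability _ (RGenOInfty.measurableE R)) => _ [_ [x ->] <-].
rewrite setTI; apply: sub_sigma_algebra => /=.
apply: (@open_comp _ _ (fun M : 'M[R]_(m, q) => M i j)).
  by move=> M _; exact: coord_continuous.
by rewrite set_itvE; exact: open_gt.
Qed.

(** Measurability on the disjoint union of the matrix spaces is checked on each
    of them. *)
Lemma measurable_sketch_fun (R : realType) m d (T : measurableType d)
    (f : sketch R m -> T) :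
  (forall q, measurable_fun [set: borel_mx R m q]
     (fun M => f (existT (fun q => 'M[R]_(m, q)) q M))) ->
  measurable_fun [set: sketch R m] f.
Proof.
move=> mf _ Y mY; rewrite setTI; change (sketch_measurable (f @^-1` Y)) => q.
by have := mf q measurableT Y mY; rewrite setTI.
Qed.

Lemma measurable_sketch_proj (R : realType) m n (A : 'M[R]_(m, n)) :
  measurable_mx (sketch_proj A).
Proof.
move=> i j; apply: measurable_sketch_fun => q.
rewrite [X in measurable_fun _ X](_ : _ =
    fun M : 'M[R]_(m, q) => range_proj (A^T *m M) i j); last first.
  by apply/funext => M; rewrite sketch_projE.
apply: measurable_range_proj; apply: measurable_mxM.
  exact: measurable_mx_cst.
by move=> k l; exact: measurable_coord.
Qed.

Lemma orthoproj_entry_le1 (R : realType) n (Q : 'M[R]_n) i j :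
  orthoproj Q -> `|Q i j| <= 1.
Proof.
move=> [Qs QQ].
have QE : Q i i = \sum_k Q i k ^+ 2.
  rewrite -{1}QQ mxE; apply: eq_bigr => k _.
  by rewrite -{2}Qs mxE expr2.
have Qsq k : Q i k ^+ 2 <= Q i i.
  rewrite QE (bigD1 k) //= lerDl sumr_ge0 // => l _; exact: sqr_ge0.
have Qii1 : Q i i <= 1 by have := Qsq i; nra.
rewrite -(expr_le1 (n := 2)) // real_normK ?num_real //.
exact: le_trans (Qsq j) Qii1.
Qed.

(** * The expected projector *)

Section expected_projector.
Context {R : realType} {m n : nat} (A : 'M[R]_(m, n)).
Context (D : probability (sketch R m) R).

Lemma integrable_sketch_proj i j :
  D.-integrable setT (EFin \o (fun S => sketch_proj A S i j)).
Proof.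
apply: measurable_bounded_integrable => //.
- by rewrite -ge0_fin_numE ?fin_num_measure.
- exact: measurable_sketch_proj.
- exists 1; split=> // x x1 S _ /=; apply: le_trans (ltW x1).
  by apply: orthoproj_entry_le1; exact: sketch_proj_orthoproj.
Qed.

Lemma WmxE i j :
  (Wmx A D i j)%:E = (\int[D]_S (sketch_proj A S i j)%:E)%E.
Proof.
rewrite mxE unlock fineK //; apply: integrable_fin_num => //.
exact: integrable_sketch_proj.
Qed.

Lemma integral_dotv_Wmx (u v : 'cV[R]_n) :
  (\int[D]_S (dotv u (sketch_proj A S *m v))%:E = (dotv u (Wmx A D *m v))%:E)%E.
Proof.
have dotE (M : 'M[R]_n) : dotv u (M *m v) =
    \sum_i \sum_j (u i ord0 * v j ord0) * M i j.
  rewrite dotvE; apply: eq_bigr => i _; rewrite mxE mulr_sumr.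
  by apply: eq_bigr => j _; rewrite mulrCA mulrA [u _ _ * _]mulrC; ring.
under eq_integral.
  move=> S _; rewrite dotE -sumEFin.
  under eq_bigr do rewrite -sumEFin.
  under eq_bigr do under eq_bigr do rewrite EFinM.
  over.
have int i j : D.-integrable setT
    (fun S => ((u i ord0 * v j ord0)%:E * (sketch_proj A S i j)%:E)%E).
  by apply: integrableZl => //; exact: integrable_sketch_proj.
rewrite integral_sum //; last first.
  by move=> i; apply: integrable_sum => // j _; exact: int.
rewrite dotE -sumEFin; apply: eq_bigr => i _.
rewrite integral_sum // -sumEFin; apply: eq_bigr => j _.
by rewrite integralZl // ?EFinM ?WmxE //; exact: integrable_sketch_proj.
Qed.

End expected_projector.

(** * Independence along a Markov chain *)

(** A finite measure on a product is determined by the measurable rectangles. *)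
Lemma rectangle_measure_unique (R : realType) d1 d2
    (T1 : measurableType d1) (T2 : measurableType d2)
    (m1 m2 : {measure set (T1 * T2) -> \bar R}) :
  (m1 setT < +oo)%E ->
  (forall A B, measurable A -> measurable B -> m1 (A `*` B) = m2 (A `*` B)) ->
  forall Y, measurable Y -> m1 Y = m2 Y.
Proof.
move=> m1T m12.
pose C : set (set (T1 * T2)) :=
  [set A `*` B | A in measurable & B in measurable].
apply: (measure_unique C (fun=> setT)) => //.
- exact: measurable_prod_measurableType.
- move=> _ _ [A mA [B mB <-]] [A' mA' [B' mB' <-]]; rewrite -setXI.
  exists (A `&` A'); first exact: measurableI.
  by exists (B `&` B') => //; exact: measurableI.
- by move=> _; exists setT => //; exists setT => //; rewrite setXTT.
- by rewrite bigcup_const //; exists 0%N.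
- by move=> _ [A mA [B mB <-]]; exact: m12.
Qed.

(** A process [X] started at a point and updated by independent inputs [S]
    through a measurable map [phi]. *)
Section markov_chain.
Context {R : realType} {d dT dU : measure_display}.
Context {Omega : measurableType d}.
Context {T : measurableType dT} {U : measurableType dU}.
Context (P : probability Omega R) (S : nat -> {RV P >-> U}).
Hypothesis S_indep : mutually_independent P (fun k => S k : Omega -> U).
Context (X : nat -> Omega -> T) (x0 : T) (phi : T * U -> T).
Hypothesis mphi : measurable_fun setT phi.
Hypothesis X0 : forall w, X 0%N w = x0.
Hypothesis XS : forall k w, X k.+1 w = phi (X k w, S k w).

Lemma measurable_chain k : measurable_fun setT (X k).
Proof.
elim: k => [|k IHk].
  by rewrite (_ : X 0%N = cst x0) ?funeqE //; exact: measurable_cst.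
rewrite (_ : X k.+1 = fun w => phi (X k w, S k w)) ?funeqE //.
by apply: (measurableT_comp mphi); exact: measurable_fun_pair.
Qed.

(** The event that the inputs with index in [I] lie in the sets [B]. *)
Let cylinder (I : {fset nat}) (B : nat -> set U) : set Omega :=
  \bigcap_(i in [set` I]) (S i @^-1` B i).

Let measurable_preim k B : measurable B -> measurable (S k @^-1` B).
Proof.
by move=> mB; rewrite -[X in measurable X]setTI; exact: measurable_funP.
Qed.

Let measurable_cylinder I B :
  (forall i, i \in I -> measurable (B i)) -> measurable (cylinder I B).
Proof.
move=> mB; apply: fin_bigcap_measurable => // i /= iI.
by apply: measurable_preim; exact: mB.
Qed.

Let measurable_chain_preim k A : measurable A -> measurable (X k @^-1` A).
Proof.
by move=> mA; rewrite -[Y in measurable Y]setTI; exact: measurable_chain.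
Qed.

(** The state at time [k] is independent of the present and future inputs.  The
    induction needs the whole future: the pair of the state and the input at
    time [k] is independent of the inputs after [k] because this holds on
    rectangles. *)
Lemma chain_indep_future k A (I : {fset nat}) (B : nat -> set U) :
  measurable A -> (forall i, i \in I -> (k <= i)%N) ->
  (forall i, i \in I -> measurable (B i)) ->
  P (X k @^-1` A `&` cylinder I B) = (P (X k @^-1` A) * P (cylinder I B))%E.
Proof.
elim: k A I B => [|k IHk] A I B mA leI mB.
  have [Ax0|nAx0] := pselect (A x0).
    rewrite (_ : X 0%N @^-1` A = setT) ?setTI ?probability_setT ?mul1e //.
    by apply/seteqP; split=> // w _ /=; rewrite X0.
  rewrite (_ : X 0%N @^-1` A = set0) ?set0I ?measure0 ?mul0e //.
  by apply/seteqP; split=> // w /=; rewrite X0.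
pose E := cylinder I B; have mE : measurable E by exact: measurable_cylinder.
pose XSk w := (X k w, S k w).
have mXSk : measurable_fun setT XSk.
  by apply: measurable_fun_pair => //; exact: measurable_chain.
have kI : k \notin I by apply/negP => /leI; rewrite ltnn.
have PE_ge0 : 0 <= fine (P E) by exact: fine_ge0.
pose m1 := pushforward (mrestr P mE) XSk.
pose m2 := pushforward (mscale (NngNum PE_ge0) P) XSk.
have PEfin : P E \is a fin_num by exact: fin_num_measure.
have preimXS Y : X k.+1 @^-1` Y = XSk @^-1` (phi @^-1` Y).
  by apply/seteqP; split=> w /=; rewrite XS.
have mXA : measurable (phi @^-1` A).
  by rewrite -[Y in measurable Y]setTI; exact: mphi.
suff : m1 (phi @^-1` A) = m2 (phi @^-1` A).
  rewrite /m1 /m2 /pushforward /mrestr /mscale /= -preimXS fineK // => ->.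
  by rewrite muleC.
apply: rectangle_measure_unique mXA.
  change (P (setT `&` E) < +oo)%E.
  by rewrite setTI -ge0_fin_numE.
move=> Y Z mY mZ.
change (P (X k @^-1` Y `&` S k @^-1` Z `&` E) =
  (fine (P E))%:E * P (X k @^-1` Y `&` S k @^-1` Z))%E.
rewrite fineK //.
(* Adjoin the constraint on the input at time [k] to the future ones. *)
pose B' i := if i == k then Z else B i.
have cylE (J : {fset nat}) : k \notin J -> cylinder J B' = cylinder J B.
  move=> kJ; apply: eq_bigcapr => i /= iJ; rewrite /B' ifN //.
  by apply: contraNneq kJ => <-.
have cylU (J : {fset nat}) : k \notin J ->
    cylinder (k |` J)%fset B' = S k @^-1` Z `&` cylinder J B.
  move=> kJ; rewrite -(cylE _ kJ) /cylinder set_fsetU1 bigcap_setU1 /=.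
  by rewrite /B' eqxx.
have mB' (J : {fset nat}) : {subset J <= I} ->
    forall i, i \in (k |` J)%fset -> measurable (B' i).
  move=> JI i; rewrite !inE /B'; case: eqP => //= _ /JI; exact: mB.
have leJ (J : {fset nat}) : {subset J <= I} ->
    forall i, i \in (k |` J)%fset -> (k <= i)%N.
  by move=> JI i; rewrite !inE => /orP[/eqP -> //|/JI/leI /ltnW].
have future (J : {fset nat}) : {subset J <= I} -> k \notin J ->
    P (X k @^-1` Y `&` (S k @^-1` Z `&` cylinder J B)) =
    (P (X k @^-1` Y) * (P (S k @^-1` Z) * P (cylinder J B)))%E.
  move=> JI kJ; rewrite -cylU // IHk //; [|exact: leJ|exact: mB'].
  congr (_ * _)%E; rewrite -(cylE _ kJ) /cylinder S_indep; last exact: mB'.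
  rewrite big_fsetU1 //= S_indep; last first.
    by move=> i iJ; apply: (mB' _ JI); rewrite !inE iJ orbT.
  by rewrite /B' eqxx.
rewrite -setIA future //.
have := future fset0; rewrite {1 2}/cylinder set_fset0 bigcap_set0.
rewrite setIT probability_setT mule1 => -> //.
by rewrite muleA muleC.
Qed.

Context (D : probability U R).
Hypothesis S_law : forall k B, measurable B -> distribution P (S k) B = D B.

(** In an integral over the state and the input at time [k], the input may be
    integrated first under its law [D], the state being fixed. *)
Lemma chain_integral k (F : T * U -> \bar R) :
  measurable_fun setT F -> (forall z, 0 <= F z)%E ->
  (\int[P]_w F (X k w, S k w) = \int[P]_w \int[D]_s F (X k w, s))%E.
Proof.
move=> mF F0.
have mX := measurable_chain k.
have mXS : measurable_fun setT (fun w => (X k w, S k w)).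
  exact: measurable_fun_pair.
pose mX_mixin := isMeasurableFun.Build _ _ _ _ _ mX.
pose Xk : {RV P >-> T} := HB.pack (X k) mX_mixin.
pose law := distribution P Xk.
have lawE Y : measurable Y ->
    (law \x D)%E Y = pushforward P (fun w => (X k w, S k w)) Y.
  apply: product_measure_unique => A B mA mB.
  change (P (X k @^-1` A `&` S k @^-1` B) = P (X k @^-1` A) * D B)%E.
  rewrite -(S_law k mB).
  change (P (X k @^-1` A `&` S k @^-1` B) =
    P (X k @^-1` A) * P (S k @^-1` B))%E.
  have := @chain_indep_future k A [fset k]%fset (fun=> B) mA.
  rewrite /cylinder set_fset1 bigcap_set1 => <- //.
  by move=> i; rewrite inE => /eqP ->.
transitivity (\int[pushforward P (fun w => (X k w, S k w))]_z F z)%E.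
  by rewrite ge0_integral_pushforward.
transitivity (\int[law \x D]_z F z)%E.
  by apply: eq_measure_integral => Y mY _; apply/esym; exact: lawE.
rewrite fubini_tonelli1 // /fubini_F ge0_integral_distribution //.
  exact: measurable_fun_fubini_tonelli_F.
by move=> x; exact: integral_ge0.
Qed.

End markov_chain.

(** * The row space and the spectrum of the expected projector *)

(** The orthogonal projector onto the row space of [A], which is the orthogonal
    complement of its kernel. *)
Definition row_proj (R : realType) (m n : nat) (A : 'M[R]_(m, n)) : 'M[R]_n :=
  mp_pinv A *m A.

Lemma row_proj_orthoproj (R : realType) m n (A : 'M[R]_(m, n)) :
  orthoproj (row_proj A).
Proof.
have [_ XAX _ XAs] := penrose_mp_pinv A; split=> //.
by rewrite /row_proj mulmxA XAX.
Qed.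

Lemma mulmx_row_proj (R : realType) m n (A : 'M[R]_(m, n)) :
  A *m row_proj A = A.
Proof. by have [AXA _ _ _] := penrose_mp_pinv A; rewrite /row_proj mulmxA. Qed.

Lemma row_proj_ker (R : realType) m n (A : 'M[R]_(m, n)) (z : 'cV[R]_n) :
  A *m z = 0 -> row_proj A *m z = 0.
Proof. by move=> Az; rewrite /row_proj -mulmxA Az mulmx0. Qed.

Lemma sketch_proj_row_proj (R : realType) m n (A : 'M[R]_(m, n)) S :
  sketch_proj A S *m row_proj A = sketch_proj A S.
Proof. by rewrite /sketch_proj -mulmxA mulmx_row_proj. Qed.

Lemma row_proj_sketch_proj (R : realType) m n (A : 'M[R]_(m, n)) S :
  row_proj A *m sketch_proj A S = sketch_proj A S.
Proof.
have [Zs _] := sketch_proj_orthoproj A S.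
have [Ts _] := row_proj_orthoproj A.
by apply: trmx_inj; rewrite trmx_mul Zs Ts sketch_proj_row_proj.
Qed.

(** The error vector at the projection of [x] onto the solution set has no
    component in the kernel of [A]. *)
Lemma euclidean_projection_row_proj (R : realType) m n (A : 'M[R]_(m, n)) b
    (x p : 'cV[R]_n) :
  is_euclidean_projection (solution_set A b) x p ->
  row_proj A *m (x - p) = x - p.
Proof.
move=> [Ap pmin]; have Tp := row_proj_orthoproj A.
set e := x - p; set T := row_proj A.
have Ly : solution_set A b (p + (e - T *m e)).
  rewrite /solution_set /= mulmxDr mulmxBr mulmxA mulmx_row_proj subrr addr0.
  exact: Ap.
have := pmin _ Ly; rewrite opprD addrA -/e opprB addrC subrK => le_e.
have : dotv e e <= dotv (T *m e) (T *m e).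
  by rewrite -!enorm_sqr lerXn2r // ?nnegrE ?sqrtr_ge0.
rewrite (orthoproj_pythagoras e Tp) gerDl => le0.
have /eqP : dotv (e - T *m e) (e - T *m e) == 0.
  by rewrite eq_le le0 dotv_ge0.
by move=> /eqP; rewrite dotv_eq0 subr_eq0 => /eqP.
Qed.

Lemma sgd_sps_row_proj (R : realType) m n (A : 'M[R]_(m, n)) b
    (S : nat -> sketch R m) (x0 c : 'cV[R]_n) k :
  A *m c = b -> row_proj A *m (x0 - c) = x0 - c ->
  row_proj A *m (sgd_sps A b S x0 k - c) = sgd_sps A b S x0 k - c.
Proof.
move=> Acb Te0; elim: k => [//|k IHk].
rewrite (sgd_sps_step S x0 k Acb); move: (_ - c) IHk => e Te.
by rewrite mulmxA mulmxBr mulmx1 row_proj_sketch_proj !mulmxBl Te mul1mx.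
Qed.

Lemma dotv_mulmx_inj (R : realType) n (M N : 'M[R]_n) :
  (forall u v, dotv u (M *m v) = dotv u (N *m v)) -> M = N.
Proof.
move=> MN; apply/matrixP => i j.
have entry (Q : 'M[R]_n) :
    Q i j = dotv (delta_mx i ord0) (Q *m delta_mx j ord0).
  by rewrite /dotv trmx_delta -rowE -colE !mxE.
by rewrite !entry.
Qed.

Section expected_projector_spectrum.
Context {R : realType} {m n : nat} (A : 'M[R]_(m, n)) (b : 'cV[R]_m).
Context (D : probability (sketch R m) R).
Let W := Wmx A D.

Lemma Wmx_sym : W^T = W.
Proof.
apply/matrixP => i j; rewrite mxE; apply: EFin_inj; rewrite !WmxE.
apply: eq_integral => S _; have [Zs _] := sketch_proj_orthoproj A S.
by rewrite -{1}Zs mxE.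
Qed.

Lemma Wmx_ge0 z : 0 <= dotv z (W *m z).
Proof.
rewrite -lee_fin -integral_dotv_Wmx; apply: integral_ge0 => S _.
by rewrite lee_fin (orthoproj_dotv _ (sketch_proj_orthoproj A S)) dotv_ge0.
Qed.

Lemma Wmx_row_proj : W *m row_proj A = W.
Proof.
apply: dotv_mulmx_inj => u v; apply: EFin_inj.
rewrite -mulmxA -!integral_dotv_Wmx; apply: eq_integral => S _.
by rewrite mulmxA sketch_proj_row_proj.
Qed.

Lemma integral_dotv_complement (z : 'cV[R]_n) :
  (\int[D]_S (dotv z ((1%:M - sketch_proj A S) *m z))%:E =
   (dotv z z - dotv z (W *m z))%:E)%E.
Proof.
rewrite EFinB -integral_dotv_Wmx.
under eq_integral do rewrite mulmxBl mul1mx dotvDr dotvNr EFinB.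
have int1 : D.-integrable setT (cst (dotv z z)%:E).
  exact: finite_measure_integrable_cst.
have int2 : D.-integrable setT (fun S => (dotv z (sketch_proj A S *m z))%:E).
  apply: measurable_bounded_integrable => //.
  - by rewrite -ge0_fin_numE ?fin_num_measure.
  - apply: measurable_dotv; first exact: measurable_mx_cst.
    apply: measurable_mxM; last exact: measurable_mx_cst.
    exact: measurable_sketch_proj.
  - exists (dotv z z); split=> [|x x1]; first exact: num_real.
    move=> S _ /=; apply: le_trans (ltW x1).
    have Zp := sketch_proj_orthoproj A S.
    rewrite (orthoproj_dotv _ Zp) ger0_norm ?dotv_ge0 //.
    by rewrite (orthoproj_pythagoras z Zp) lerDl dotv_ge0.
rewrite integralB // integral_cst //.
by rewrite [X in (_ * X)%E](_ : _ = 1%E) ?mule1 //; exact: probability_setT.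
Qed.

Lemma Wmx_le z : dotv z (W *m z) <= dotv z z.
Proof.
rewrite -subr_ge0 -lee_fin -integral_dotv_complement.
apply: integral_ge0 => S _.
have Zp := orthoprojC (sketch_proj_orthoproj A S).
by rewrite lee_fin (orthoproj_dotv _ Zp) dotv_ge0.
Qed.

Lemma f_DE (c x : 'cV[R]_n) : A *m c = b ->
  f_D A b D x = (2^-1 * dotv (x - c) (W *m (x - c)))%:E.
Proof.
move=> Acb; rewrite /f_D unlock -dotvZl -integral_dotv_Wmx.
by apply: eq_integral => S _; rewrite (f_SE S x Acb) dotvZl.
Qed.

(** Under exactness, the kernel of [W] is contained in that of [A]: adding a
    kernel vector of [W] to a solution keeps the objective at its minimum 0. *)
Lemma Wmx_ker (c z : 'cV[R]_n) :
  minimizers (f_D A b D) = solution_set A b -> A *m c = b ->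
  W *m z = 0 -> A *m z = 0.
Proof.
move=> exact Acb Wz.
have : minimizers (f_D A b D) (c + z).
  move=> y; rewrite !(f_DE _ Acb) addrC addKr Wz dotvC dot0v mulr0 lee_fin.
  by rewrite mulr_ge0 ?invr_ge0 ?Wmx_ge0.
rewrite exact /solution_set /= mulmxDr Acb => bAz.
by apply: (addrI b); rewrite bAz addr0.
Qed.

End expected_projector_spectrum.

(** * Linear convergence *)

Unset Implicit Arguments.

Theorem theoremB3 (R : realType) (m n : nat) (A : 'M[R]_(m, n)) (b : 'cV[R]_m)
    (A_neq0 : A != 0)
    (consistent : exists x : 'cV[R]_n, A *m x = b)
    (D : probability (sketch R m) R)
    (exactness : minimizers (f_D A b D) = solution_set A b)
    (d : measure_display) (Omega : measurableType d) (P : probability Omega R)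
    (S : nat -> {RV P >-> sketch R m})
    (S_law : forall (k : nat) (B : set (sketch R m)),
       measurable B -> distribution P (S k) B = D B)
    (S_indep : mutually_independent P (fun k => S k : Omega -> sketch R m))
    (x0 xstar : 'cV[R]_n)
    (xstar_proj : is_euclidean_projection (solution_set A b) x0 xstar)
    (k : nat) :
  ('E_P[fun w => (enorm (sgd_sps A b (fun i => S i w) x0 k - xstar) ^+ 2)%R]
    <= ((1 - lambda_min_plus (Wmx A D)) ^+ k * enorm (x0 - xstar) ^+ 2)%:E)%E.
Proof.
have [Axs _] := xstar_proj; have Acb : A *m xstar = b := Axs.
have Te0 := euclidean_projection_row_proj xstar_proj.
have Tp := row_proj_orthoproj A.
set lam := lambda_min_plus _.
pose err k w := sgd_sps A b (fun i => S i w) x0 k - xstar.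
have kerW (z : 'cV[R]_n) : row_proj A *m z = z -> Wmx A D *m z = 0 -> z = 0.
  by move=> Tz Wz; rewrite -Tz row_proj_ker // (Wmx_ker exactness Acb Wz).
have rayleigh (z : 'cV[R]_n) : row_proj A *m z = z ->
    lam * dotv z z <= dotv z (Wmx A D *m z).
  move=> Tz; apply: lambda_min_plus_le Tz => //; first exact: Wmx_sym.
    exact: Wmx_ge0.
  exact: Wmx_row_proj.
(* Since [A != 0], the row space contains a nonzero vector; comparing [W] with
   the identity there bounds [lam] by 1. *)
have lam_le1 : 0 <= 1 - lam.
  have /matrix0Pn[i [j Aij]] := A_neq0.
  pose z : 'cV[R]_n := row_proj A *m delta_mx j ord0.
  have z0 : z != 0.
    apply: contraNneq Aij => z0; have : A *m z = 0 by rewrite z0 mulmx0.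
    by rewrite mulmxA mulmx_row_proj -colE => /colP/(_ i); rewrite !mxE => ->.
  have zz : 0 < dotv z z by rewrite lt_def dotv_eq0 z0 dotv_ge0.
  have Tz : row_proj A *m z = z by have [_ TT] := Tp; rewrite mulmxA TT.
  rewrite subr_ge0 -(ler_pM2r zz) mul1r.
  exact: le_trans (rayleigh _ Tz) (Wmx_le A D z).
(* The error process is a Markov chain driven by the sketches.  Its states are
   coded as tuples, which carry the product sigma-algebra. *)
pose vec (t : n.-tuple R) : 'cV[R]_n := \col_i tnth t i.
pose tup (v : 'cV[R]_n) : n.-tuple R := [tuple v i ord0 | i < n].
have tupK : cancel tup vec.
  by move=> v; apply/colP => i; rewrite mxE tnth_mktuple.
have mvec : measurable_mx (fun z : n.-tuple R * sketch R m => vec z.1).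
  move=> i j; rewrite [X in measurable_fun _ X](_ : _ =
    (fun t : n.-tuple R => tnth t i) \o fst); last first.
    by apply/funext => z /=; rewrite mxE.
  by apply: measurableT_comp => //; exact: measurable_tnth.
have mcompl : measurable_mx
    (fun z : n.-tuple R * sketch R m => 1%:M - sketch_proj A z.2).
  apply: measurable_mxD; first exact: measurable_mx_cst.
  apply: measurable_mxN => i j.
  exact: (measurableT_comp (measurable_sketch_proj A i j) measurable_snd).
pose phi (z : n.-tuple R * sketch R m) : n.-tuple R :=
  tup ((1%:M - sketch_proj A z.2) *m vec z.1).
have mphi : measurable_fun setT phi.
  apply/measurable_fun_tnthP => i.
  rewrite [X in measurable_fun _ X](_ : _ =
    fun z => ((1%:M - sketch_proj A z.2) *m vec z.1) i ord0); last first.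
    by apply/funext => z /=; rewrite tnth_mktuple.
  exact: measurable_mxM.
pose F (z : n.-tuple R * sketch R m) : \bar R :=
  (dotv (vec z.1) ((1%:M - sketch_proj A z.2) *m vec z.1))%:E.
have mF : measurable_fun setT F.
  apply/measurable_EFinP; apply: measurable_dotv => //.
  exact: measurable_mxM.
have F0 z : (0 <= F z)%E.
  have Zp := orthoprojC (sketch_proj_orthoproj A z.2).
  by rewrite lee_fin (orthoproj_dotv _ Zp) dotv_ge0.
pose X k w := tup (err k w).
have X0 w : X 0%N w = tup (x0 - xstar) by [].
have XS k' w : X k'.+1 w = phi (X k' w, S k' w).
  by rewrite /X /phi /= tupK /err (sgd_sps_step (fun i => S i w) x0 k' Acb).
have merr k' : measurable_mx (err k').
  move=> i j; have mX := measurable_chain mphi X0 XS k'.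
  move/measurable_fun_tnthP : mX => /(_ i).
  rewrite [X in measurable_fun _ X](_ : _ = fun w => err k' w i j) //.
  by apply/funext => w /=; rewrite tnth_mktuple (ord1 j).
rewrite unlock enorm_sqr.
under eq_integral do rewrite enorm_sqr.
elim: k => [|k IHk].
  rewrite expr0 mul1r.
  rewrite (eq_integral (cst (dotv (x0 - xstar) (x0 - xstar))%:E)) //.
  rewrite integral_cst // [X in (_ * X)%E](_ : _ = 1%E) ?mule1 //.
  exact: probability_setT.
(* Integrate first over the sketch of step [k], the error being fixed. *)
have -> : (\int[P]_w (dotv (err k.+1 w) (err k.+1 w))%:E =
    \int[P]_w (dotv (err k w) (err k w) -
                dotv (err k w) (Wmx A D *m err k w))%:E)%E.
  transitivity (\int[P]_w F (X k w, S k w))%E.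
    apply: eq_integral => w _; rewrite /F /= tupK.
    have Zp := orthoprojC (sketch_proj_orthoproj A (S k w)).
    rewrite (orthoproj_dotv _ Zp) {1 2}/err.
    by rewrite (sgd_sps_step (fun i => S i w) x0 k Acb).
  rewrite (chain_integral S_indep mphi X0 XS S_law) //.
  apply: eq_integral => w _; rewrite -integral_dotv_complement.
  by apply: eq_integral => s _; rewrite /F /= tupK.
have mdot : measurable_fun setT (fun w => dotv (err k w) (err k w)).
  exact: measurable_dotv.
apply: (@le_trans _ _
  (\int[P]_w ((1 - lam)%:E * (dotv (err k w) (err k w))%:E))%E).
  apply: ge0_le_integral => //.
  - by move=> w _; rewrite lee_fin subr_ge0 Wmx_le.
  - apply/measurable_EFinP; apply: measurable_funB => //.
    by apply: measurable_dotv => //; apply: measurable_mxM => //.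
  - by apply/measurable_EFinP; exact: measurable_funM.
  - move=> w _; rewrite -EFinM lee_fin mulrBl mul1r lerD2l lerN2.
    by apply: rayleigh; exact: sgd_sps_row_proj.
rewrite ge0_integralZl_EFin //; last 2 first.
- by move=> w _; rewrite lee_fin dotv_ge0.
- exact/measurable_EFinP.
by rewrite exprS -mulrA EFinM lee_wpmul2l ?lee_fin.
Qed.
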